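(* Let $x,t$ be real numbers with $t\ge 0$. Then for every integer $k\ge 0$, $P_k(x-t,\,t,\,-t,\,t,\ldots)=(-1)^k\mathcal{L}_k^{t-k}(x)$ and $P_k(t-x,\,t,\,t,\ldots)=\mathcal{L}_k^{t-k}(x)$, where $P_k$ is the $k$-th Kailath-Segall polynomial and $\mathcal{L}_k^{t-k}(x)$ is the Laguerre polynomial.
   Context: The Kailath-Segall polynomials $P_n(x_1,\ldots,x_n)$ in the indeterminates $x_1,x_2,\ldots$ are defined by $P_0=1$ and, for $n\ge 1$, by the recursion $P_n=\frac1n\left(P_{n-1}x_1-P_{n-2}x_2+\cdots+(-1)^{n+1}P_0x_n\right)$, where $P_j$ abbreviates $P_j(x_1,\ldots,x_j)$. Equivalently, as formal power series, $\sum_{n\ge 0}P_n(x_1,\ldots,x_n)z^n=\exp\left(\sum_{n\ge 1}\frac{(-1)^{n+1}}{n}x_nz^n\right)$. In the first identity one substitutes $x_1=x-t$ and $x_i=(-1)^it$ for $i\ge 2$; in the second, $x_1=t-x$ and $x_i=t$ for $i\ge 2$ (only the first $k$ of these values are used). The Laguerre polynomials $\mathcal{L}_k^{t-k}(x)$ are characterized by $\sum_{k\ge 0}(-1)^k\,k!\,\mathcal{L}_k^{t-k}(x)\frac{z^k}{k!}=e^{xz}(1-z)^t$; that is, $\mathcal{L}_k^{t-k}(x)$ is the generalized Laguerre polynomial of degree $k$ with parameter $t-k$. *)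

(* Defs.v *)
From Stdlib Require Import Reals Lra Lia Arith List.
From Coquelicot Require Import Coquelicot.
Open Scope R_scope.

(** * Kailath-Segall polynomials *)

(** The indeterminates [x_1, x_2, ...] are evaluated at [x 1, x 2, ...];
    the entry [x 0] is never used.  [KS_table x n] is [P_n; ...; P_1; P_0]. *)
Fixpoint KS_table (x : nat -> R) (n : nat) : list R :=
  match n with
  | O => 1 :: nil
  | S m =>
      (/ INR (S m) *
       sum_f_R0 (fun j => (-1) ^ j * nth j (KS_table x m) 0 * x (S j)) m)
      :: KS_table x m
  end.

Definition KS (n : nat) (x : nat -> R) : R := hd 0 (KS_table x n).

Lemma KS_table_nth (x : nat -> R) (n j : nat) :
  (j <= n)%nat -> nth j (KS_table x n) 0 = KS (n - j) x.
Proof.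
revert j; induction n as [|n IH]; intros [|j] Hj; try lia; try reflexivity.
exact (IH j (le_S_n _ _ Hj)).
Qed.

Lemma KS_0 (x : nat -> R) : KS 0 x = 1.
Proof. reflexivity. Qed.

Lemma KS_rec (x : nat -> R) (n : nat) : (1 <= n)%nat ->
  KS n x = / INR n * sum_n_m (fun i => (-1) ^ (i + 1) * KS (n - i) x * x i) 1 n.
Proof.
intros Hn; destruct n as [|m]; [lia|]; clear Hn.
change (KS (S m) x) with
  (/ INR (S m) *
   sum_f_R0 (fun j => (-1) ^ j * nth j (KS_table x m) 0 * x (S j)) m).
f_equal.
rewrite <- sum_n_m_S.
change (sum_n_m (fun n : nat => (-1) ^ (S n + 1) * KS (S m - S n) x * x (S n)) 0 m)
  with (sum_n (fun n : nat => (-1) ^ (S n + 1) * KS (S m - S n) x * x (S n)) m).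
rewrite sum_n_Reals.
apply sum_eq; intros j Hj.
rewrite KS_table_nth by exact Hj.
replace (S j + 1)%nat with (S (S j)) by lia.
replace (S m - S j)%nat with (m - j)%nat by lia.
simpl; ring.
Qed.

(** * Laguerre polynomials *)

(** [L k a x] stands for the generalized Laguerre polynomial of degree [k]
    with parameter [a] at [x].  The generating function determines [L]: every
    pair [(k, a)] is reached, from [t = a + k], and the coefficients of a
    convergent power series are unique.  [Rpower] is the usual real power here,
    since [0 < 1 - z]. *)
Definition is_laguerre (L : nat -> R -> R -> R) : Prop :=
  forall x t z : R, Rabs z < 1 ->
    is_series
      (fun k => (-1) ^ k * INR (fact k) * L k (t - INR k) x
                * (z ^ k / INR (fact k)))
      (exp (x * z) * Rpower (1 - z) t).

(** The textbook generalized Laguerre polynomials satisfy [is_laguerre]. *)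

(** Generalized binomial coefficient [a (a - 1) ... (a - j + 1) / j!]. *)
Fixpoint gbinom (a : R) (j : nat) : R :=
  match j with
  | O => 1
  | S i => gbinom a i * (a - INR i) / INR (S i)
  end.

Definition laguerre (k : nat) (a x : R) : R :=
  sum_f_R0
    (fun i => (-1) ^ i * gbinom (a + INR k) (k - i) * x ^ i / INR (fact i)) k.

Lemma CV_radius_gt (a : nat -> R) (u r : R) :
  Rabs u < r -> ex_pseries a r -> Rbar_lt (Rabs u) (CV_radius a).
Proof.
intros Hu Hr.
assert (H0 : 0 <= Rabs u) by apply Rabs_pos.
apply Rbar_lt_le_trans with r; [exact Hu|].
apply Rbar_not_lt_le; intros H.
rewrite <- (Rabs_pos_eq r) in H by lra.
apply CV_disk_outside in H; apply H.
apply ex_series_lim_0.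
apply ex_series_ext with (2 := Hr); intros n.
now rewrite pow_n_pow, Rmult_comm.
Qed.

Lemma is_pseries_exp_scal (c u : R) :
  is_pseries (fun i => c ^ i / INR (fact i)) u (exp (c * u)).
Proof.
apply is_pseries_R.
apply is_series_ext with (2 := proj1 (is_pseries_R _ _ _) (is_exp_Reals (c * u))).
intros n; rewrite Rpow_mult_distr.
match goal with |- ?a = ?b => change (@eq R a b) end.
unfold Rdiv; ring.
Qed.

Lemma gbinom_major (t : R) (n : nat) :
  Rabs (gbinom t n) <= Rabs (gbinom (- (Rabs t + 1)) n) /\
  gbinom (- (Rabs t + 1)) n <> 0.
Proof.
assert (Ht := Rabs_pos t).
induction n as [|n [IH1 IH2]]; [simpl; split; lra|].
assert (Hn := pos_INR n).
assert (HS : 0 < INR (S n)) by (apply lt_0_INR; lia).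
cbn -[INR]; split.
- unfold Rdiv; rewrite !Rabs_mult.
  apply Rmult_le_compat_r; [apply Rabs_pos|].
  apply Rmult_le_compat; try apply Rabs_pos; trivial.
  unfold Rabs in *; repeat destruct Rcase_abs; lra.
- unfold Rdiv; repeat apply Rmult_integral_contrapositive_currified; trivial.
  + lra.
  + apply Rinv_neq_0_compat; lra.
Qed.

Lemma gbinom_CV (t u : R) :
  Rabs u < 1 -> Rbar_lt (Rabs u) (CV_radius (gbinom t)).
Proof.
intros Hu.
assert (H0 := Rabs_pos u); assert (Ht := Rabs_pos t).
set (r := (Rabs u + 1) / 2).
assert (Hr : Rabs u < r < 1) by (unfold r; lra).
apply CV_radius_gt with r; [lra|].
set (T := - (Rabs t + 1)).
assert (HT : CV_radius (gbinom T) = / 1).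
{ apply CV_radius_finite_DAlembert; [|lra|].
  - intros n; apply (gbinom_major t n).
  - apply is_lim_seq_ext with (fun n => 1 + Rabs t * / (INR n + 1)).
    + intros n.
      assert (Hn := pos_INR n).
      assert (HB := proj2 (gbinom_major t n)); fold T in HB.
      cbn [gbinom]; rewrite S_INR.
      replace (gbinom T n * (T - INR n) / (INR n + 1) / gbinom T n)
        with (- (1 + Rabs t * / (INR n + 1)))
        by (unfold T in *; field; split; [lra | exact HB]).
      rewrite Rabs_Ropp, (Rabs_pos_eq (1 + _)); trivial.
      assert (0 <= Rabs t * / (INR n + 1)); [|lra].
      apply Rmult_le_pos; trivial.
      apply Rlt_le, Rinv_0_lt_compat; lra.
    + replace (Finite 1) with (Finite (1 + Rabs t * 0)) by (f_equal; ring).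
      apply is_lim_seq_plus'; [apply is_lim_seq_const|].
      apply (is_lim_seq_scal_l _ _ (Finite 0)).
      apply is_lim_seq_ext with (fun n => / INR (S n)).
      { intros n; now rewrite S_INR. }
      apply (is_lim_seq_incr_1 (fun n => / INR n)).
      replace (Finite 0) with (Rbar_inv p_infty) by reflexivity.
      apply is_lim_seq_inv; [apply is_lim_seq_INR | discriminate]. }
assert (Hs : ex_series (fun n => Rabs (gbinom T n * r ^ n))).
{ apply CV_disk_inside; rewrite HT, Rabs_pos_eq by lra; simpl; lra. }
apply (@ex_series_le R_AbsRing R_CompleteNormedModule) with (2 := Hs).
intros n.
rewrite pow_n_pow; unfold scal; simpl; unfold mult; simpl.
unfold norm; simpl; unfold abs; simpl.
rewrite !Rabs_mult, Rmult_comm.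
apply Rmult_le_compat_r; [apply Rabs_pos | apply (gbinom_major t n)].
Qed.

Lemma PSeries_gbinom (t u : R) :
  Rabs u < 1 -> PSeries (gbinom t) u = Rpower (1 + u) t.
Proof.
intros Hu.
set (f := PSeries (gbinom t)).
assert (Hode : forall v, Rabs v < 1 ->
  is_derive (fun w => f w * Rpower (1 + w) (- t)) v 0).
{ intros v Hv.
  assert (Hv1 : 0 < 1 + v) by (apply Rabs_def2 in Hv; lra).
  assert (Hf : is_derive f v (PSeries (PS_derive (gbinom t)) v)).
  { apply is_derive_PSeries, gbinom_CV, Hv. }
  set (f' := PSeries (PS_derive (gbinom t)) v) in *.
  assert (Heq : f' + v * f' = t * f v).
  { unfold f', f; rewrite <- PSeries_incr_1, <- PSeries_scal.
    assert (Hex : ex_pseries (PS_derive (gbinom t)) v).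
    { apply CV_radius_inside; rewrite CV_radius_derive.
      apply gbinom_CV, Hv. }
    rewrite <- PSeries_plus; trivial.
    2: now apply ex_pseries_incr_1.
    apply PSeries_ext; intros n.
    unfold PS_plus, PS_derive, PS_incr_1, PS_scal, plus, scal, mult; simpl.
    unfold mult; simpl.
    destruct n as [|n]; [unfold zero; simpl; field|].
    change (match n with 0%nat => 1 | S _ => INR n + 1 end)
      with (INR (S n)).
    cbn -[INR]; rewrite !S_INR; assert (Hn := pos_INR n).
    field; repeat split; lra. }
  assert (Hg : is_derive (fun w => Rpower (1 + w) (- t)) v
                 (- t / (1 + v) * Rpower (1 + v) (- t))).
  { unfold Rpower; auto_derive; [exact Hv1 | field; lra]. }
  assert (H := is_derive_mult f _ v _ _ Hf Hg Rmult_comm).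
  unfold plus, mult in H; simpl in H.
  replace 0 with (f' * Rpower (1 + v) (- t)
                  + f v * (- t / (1 + v) * Rpower (1 + v) (- t))); trivial.
  replace f' with (t * f v / (1 + v)) by (rewrite <- Heq; field; lra).
  field; lra. }
assert (H0 : f 0 * Rpower (1 + 0) (- t) = 1).
{ unfold f; rewrite PSeries_0, Rplus_0_r; unfold Rpower; rewrite ln_1.
  rewrite Rmult_0_r, exp_0; simpl; ring. }
assert (Hc : f u * Rpower (1 + u) (- t) = 1).
{ apply Rabs_def2 in Hu; apply eq_trans with (2 := H0).
  destruct (Rtotal_order u 0) as [Hn|[->|Hp]]; [|reflexivity|].
  - apply (eq_is_derive (fun w => f w * Rpower (1 + w) (- t))); trivial.
    intros v Hv; apply Hode, Rabs_def1; lra.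
  - symmetry.
    apply (eq_is_derive (fun w => f w * Rpower (1 + w) (- t))); trivial.
    intros v Hv; apply Hode, Rabs_def1; lra. }
rewrite Rpower_Ropp in Hc.
assert (HR : 0 < Rpower (1 + u) t) by apply exp_pos.
replace (f u) with (f u * / Rpower (1 + u) t * Rpower (1 + u) t)
  by (field; lra).
rewrite Hc; ring.
Qed.

Lemma laguerre_is_laguerre : is_laguerre laguerre.
Proof.
intros x t z Hz.
assert (Hu : Rabs (- z) < 1) by now rewrite Rabs_Ropp.
replace (x * z) with (- x * - z) by ring.
replace (1 - z) with (1 + - z) by ring.
rewrite <- PSeries_gbinom by exact Hu.
assert (Hb : is_pseries (gbinom t) (- z) (PSeries (gbinom t) (- z))).
{ apply PSeries_correct, CV_radius_inside, gbinom_CV, Hu. }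
assert (HM := is_pseries_mult _ _ _ _ _ (is_pseries_exp_scal (- x) (- z)) Hb).
apply is_series_ext with (2 := HM
  (CV_radius_gt _ _ 1 Hu (ex_intro _ _ (is_pseries_exp_scal (- x) 1)))
  (gbinom_CV _ _ Hu)).
intros k; rewrite pow_n_pow; unfold scal; simpl; unfold mult; simpl.
replace (- z) with (-1 * z) by ring; rewrite Rpow_mult_distr.
replace (PS_mult (fun i : nat => (- x) ^ i / INR (fact i)) (gbinom t) k)
  with (laguerre k (t - INR k) x).
{ field; apply INR_fact_neq_0. }
unfold laguerre, PS_mult; apply sum_eq; intros i _.
replace (t - INR k + INR k) with t by ring.
replace (- x) with (-1 * x) by ring; rewrite Rpow_mult_distr.
field; apply INR_fact_neq_0.
Qed.

(* Main.v *)
Require Import Defs.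
From Stdlib Require Import Reals Lra Lia Arith.
From Coquelicot Require Import Coquelicot.
Open Scope R_scope.

(** The recursion for the Kailath-Segall polynomials says that their generating
    function [F] satisfies [F' = B F] with [B z = x_1 - x_2 z + x_3 z^2 - ...],
    and with [F 0 = 1] this determines the coefficients.  For [x_1 = x - t] and
    [x_i = (-1)^i t] one gets [B z = x - t / (1 - z)], the logarithmic
    derivative of [exp (x z) (1 - z)^t].  The second identity follows from the
    first since [P_n] is homogeneous of weight [n] when [x_i] has weight [i]. *)

Lemma KS_S (x : nat -> R) (n : nat) :
  INR (S n) * KS (S n) x
    = sum_f_R0 (fun j => (-1) ^ j * KS (n - j) x * x (S j)) n.
Proof.
change (KS (S n) x) with
  (/ INR (S n) *
   sum_f_R0 (fun j => (-1) ^ j * List.nth j (KS_table x n) 0 * x (S j)) n).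
rewrite <- Rmult_assoc, Rinv_r, Rmult_1_l by (apply not_0_INR; lia).
apply sum_eq; intros j Hj; now rewrite KS_table_nth.
Qed.

(** Since [INR (S n)] is invertible, the recursion determines each term from all earlier ones; hence
    the strong induction. *)
Lemma KS_unique (x a : nat -> R) :
  a 0%nat = 1 ->
  (forall n, INR (S n) * a (S n)
             = sum_f_R0 (fun j => (-1) ^ j * a (n - j)%nat * x (S j)) n) ->
  forall n, KS n x = a n.
Proof.
intros Ha0 Ha n; induction n as [[|n] IH] using lt_wf_ind.
- now rewrite Ha0.
- apply Rmult_eq_reg_l with (INR (S n)); [|apply not_0_INR; lia].
  rewrite KS_S, Ha; apply sum_eq; intros j Hj.
  rewrite IH; [reflexivity | lia].
Qed.

(** Weighted homogeneity: in each summand the weights n - j and j + 1 add up to n + 1, so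
    [c ^ n * KS n x] obeys the recursion for [y]. *)
Lemma KS_scale (c : R) (x y : nat -> R) (n : nat) :
  (forall i, (1 <= i)%nat -> y i = c ^ i * x i) -> KS n y = c ^ n * KS n x.
Proof.
intros Hy; revert n; apply KS_unique; [rewrite KS_0; simpl; ring|].
intros n.
replace (INR (S n) * (c ^ S n * KS (S n) x))
  with (c ^ S n * (INR (S n) * KS (S n) x)) by ring.
rewrite KS_S, scal_sum; apply sum_eq; intros j Hj.
rewrite Hy by lia.
replace (S n) with ((n - j) + S j)%nat by lia; rewrite pow_add; ring.
Qed.

(** Comparing coefficients in F' = B F gives exactly the recursion. Positive radii justify the
    Cauchy product and the comparison near 0. *)
Lemma KS_log_derivative (x a : nat -> R) :
  a 0%nat = 1 ->
  Rbar_lt 0 (CV_radius a) ->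
  Rbar_lt 0 (CV_radius (fun j => (-1) ^ j * x (S j))) ->
  locally 0 (fun z => is_derive (PSeries a) z
    (PSeries (fun j => (-1) ^ j * x (S j)) z * PSeries a z)) ->
  forall n, KS n x = a n.
Proof.
intros Ha0 Ha Hb HF.
set (b := fun j => (-1) ^ j * x (S j)) in *.
assert (Heq : forall n, PS_derive a n = PS_mult b a n).
{ assert (Hnear : forall c, Rbar_lt 0 (CV_radius c) ->
            locally 0 (fun z => Rbar_lt (Rabs z) (CV_radius c))).
  { intros c Hc; destruct (CV_radius c) as [r| |]; simpl in *; try easy.
    - exists (mkposreal r Hc); intros z Hz.
      change (Rabs (z - 0) < r) in Hz; now rewrite Rminus_0_r in Hz.
    - exists (mkposreal 1 Rlt_0_1); easy. }
  intros n; apply PSeries_ext_recip.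
  - now rewrite CV_radius_derive.
  (* The point [eps / 2] lies inside both discs of convergence, so the Cauchy product converges
     there and has positive radius. *)
  - destruct (filter_and _ _ (Hnear a Ha) (Hnear b Hb)) as [[eps Heps] He].
    destruct (He (eps / 2)) as [Hza Hzb].
    { change (Rabs (eps / 2 - 0) < eps); apply Rabs_def1; lra. }
    rewrite <- Rabs_R0; apply CV_radius_gt with (eps / 2).
    + rewrite Rabs_R0; lra.
    + now apply ex_pseries_mult.
  - generalize (filter_and _ _ HF
      (filter_and _ _ (Hnear a Ha) (Hnear b Hb))).
    apply filter_imp; intros z [Hd [Hza Hzb]].
    rewrite PSeries_mult by trivial.
    rewrite <- (is_derive_unique _ _ _ Hd).
    symmetry; now apply is_derive_unique, is_derive_PSeries. }
apply KS_unique; trivial.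
intros n; specialize (Heq n); unfold PS_derive in Heq; rewrite Heq.
unfold PS_mult; apply sum_eq; intros j _; unfold b; ring.
Qed.

Lemma is_pseries_linear_minus_geom (x t z : R) : Rabs z < 1 ->
  is_pseries (fun j => (if Nat.eqb j 0 then x else 0) - t) z (x - t / (1 - z)).
Proof.
intros Hz.
apply (is_pseries_minus (fun j => if Nat.eqb j 0 then x else 0) (fun _ => t)).
- apply is_pseries_R, (is_lim_seq_ext (fun _ => x) _ x);
    [|apply is_lim_seq_const].
  intros n; rewrite sum_n_Reals.
  induction n as [|n IH]; [|rewrite tech5, <- IH]; simpl; ring.
- apply is_pseries_R.
  apply (is_series_scal_l t (fun n => z ^ n) (/ (1 - z))).
  now apply is_series_geom.
Qed.

Theorem mainTheorem3 (L : nat -> R -> R -> R) (HL : is_laguerre L)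
    (x t : R) (ht : 0 <= t) (k : nat) :
  KS k (fun i => if Nat.eqb i 1 then x - t else (-1) ^ i * t)
    = (-1) ^ k * L k (t - INR k) x
  /\ KS k (fun i => if Nat.eqb i 1 then t - x else t) = L k (t - INR k) x.
Proof.
set (y := fun i => if Nat.eqb i 1 then x - t else (-1) ^ i * t).
set (a := fun k => (-1) ^ k * L k (t - INR k) x).
assert (Hsgn : forall n, (-1) ^ n * (-1) ^ n = 1).
{ intros n; rewrite <- Rpow_mult_distr.
  replace (-1 * -1) with 1 by ring; apply pow1. }
(* For j >= 1 the signs (-1)^j and (-1)^(j+1) leave -t; only j = 0 sees the exceptional value x -
   t. *)
assert (Hb : forall j, (if Nat.eqb j 0 then x else 0) - t
                       = (-1) ^ j * y (S j)).
{ intros [|j]; unfold y; [simpl; ring|].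
  change (0 - t = (-1) ^ S j * (-1 * (-1) ^ S j * t)).
  replace (0 - t) with (- t * 1) by ring; rewrite <- (Hsgn (S j)); ring. }
assert (HB : forall z, Rabs z < 1 ->
  is_pseries (fun j => (-1) ^ j * y (S j)) z (x - t / (1 - z))).
{ intros z Hz; apply is_pseries_ext with (1 := Hb).
  now apply is_pseries_linear_minus_geom. }
assert (HA : forall z, Rabs z < 1 ->
  is_pseries a z (exp (x * z) * Rpower (1 - z) t)).
{ intros z Hz; apply is_pseries_R.
  apply is_series_ext with (2 := HL x t z Hz); intros n.
  unfold a; simpl; field; apply INR_fact_neq_0. }
assert (Hhalf : Rabs (1 / 2) < 1) by (apply Rabs_def1; lra).
assert (Hpos : forall c, ex_pseries c (1 / 2) -> Rbar_lt 0 (CV_radius c)).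
{ intros c Hc; rewrite <- Rabs_R0.
  apply CV_radius_gt with (2 := Hc); rewrite Rabs_R0; lra. }
assert (HKS : forall n, KS n y = a n).
{ apply KS_log_derivative.
  (* [L] is known only through its generating function, so [a 0] is read off as the value at z =
     0. *)
  - rewrite <- (PSeries_0 a), (is_pseries_unique _ _ _ (HA 0 ltac:(rewrite Rabs_R0; lra))).
    unfold Rpower; rewrite Rminus_0_r, ln_1, !Rmult_0_r, exp_0; ring.
  - apply Hpos; eexists; now apply HA.
  - apply Hpos; eexists; now apply HB.
  - exists (mkposreal 1 Rlt_0_1); intros z Hz.
    change (Rabs (z - 0) < 1) in Hz; rewrite Rminus_0_r in Hz.
    rewrite (is_pseries_unique _ _ _ (HB z Hz)).
    rewrite (is_pseries_unique _ _ _ (HA z Hz)).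
    (* The closed form is available only for |w| < 1, so it replaces the series on a neighbourhood
       of z. *)
    apply is_derive_ext_loc with (fun w => exp (x * w) * Rpower (1 - w) t).
    + apply Rabs_def2 in Hz; apply (locally_interval _ z (-1) 1); simpl; try lra.
      intros w H1 H2; symmetry.
      apply is_pseries_unique, HA, Rabs_def1; simpl in *; lra.
    + apply Rabs_def2 in Hz; unfold Rpower.
      auto_derive; [lra | unfold Rminus; field; lra]. }
split; [exact (HKS k)|].
(* Scaling by c = -1 turns x - t into t - x and (-1)^i t into t. *)
rewrite (KS_scale (-1) y).
- rewrite HKS; unfold a; rewrite <- Rmult_assoc, Hsgn; ring.
- intros i _; unfold y; destruct (Nat.eqb_spec i 1) as [->|_]; [simpl; ring|].
  rewrite <- Rmult_assoc, Hsgn; ring.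
Qed.
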